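(* Let $0<\alpha\le1$ and $0<\delta\le0.05$. Then the Hurwitz zeta-function satisfies $$\alpha^{-1}\left(1+\frac{\alpha}{\delta}\right)^{-\frac{7}{6\delta}}10^{-\frac{9}{\delta}}\ \le\ \inf_{T\in\mathbb{R}}\int_T^{T+\delta}|\zeta(1+it,\alpha)|\,dt .$$
   Context: $\zeta(s,\alpha)$ is the Hurwitz zeta-function, $\zeta(s,\alpha)=\sum_{n=0}^\infty(n+\alpha)^{-s}$ for $\operatorname{Re}(s)>1$, continued analytically to $\mathbb{C}\setminus\{1\}$ (simple pole at $s=1$; the integral is $+\infty$ when $0\in[T,T+\delta]$). *)

(* Defs.v *)
From HB Require Import structures.
From mathcomp Require Import all_boot all_order all_algebra.
From mathcomp Require Export complex.
From mathcomp Require Import all_classical all_reals all_analysis.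
Import Order.TTheory GRing.Theory Num.Theory.
Import numFieldNormedType.Exports.

Set Implicit Arguments.
Unset Strict Implicit.
Unset Printing Implicit Defensive.

Local Open Scope classical_set_scope.
Local Open Scope ring_scope.
Local Open Scope complex_scope.

(* [cpow x s] is the principal value x ^ s = exp (s * ln x) of a complex power
   of a real base; it is only meaningful for 0 < x. *)
Definition cpow (R : realType) (x : R) (s : R[i]) : R[i] :=
  (expR (complex.Re s * ln x))%:C *
  (cos (complex.Im s * ln x) +i* sin (complex.Im s * ln x)).

(* [Z] is the Hurwitz zeta-function of parameter [alpha]: it is the sum of the
   Dirichlet series on the half-plane Re s > 1, and it is holomorphic on C
   deprived of 1.  By the identity theorem these two properties determine Z
   except for the junk value Z 1.  Since R[i]^o is a normed module over R[i]
   itself, [derivable] in direction 1 is complex differentiability. *)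
Definition is_hurwitz_zeta (R : realType) (alpha : R) (Z : R[i] -> R[i]) :
    Prop :=
  (forall s : R[i], 1 < complex.Re s ->
     (fun N : nat => (\sum_(0 <= n < N) cpow (n%:R + alpha) (- s) : R[i]^o))
       @ \oo --> (Z s : R[i]^o)) /\
  (forall s : R[i], s != 1 -> derivable (Z : R[i]^o -> R[i]^o) s 1).

(* Lebesgue integral of |Z (1 + i t)| over [T, T + delta], as an extended real:
   if the interval contains the pole t = 0 the integral is +oo, whatever the
   value Z 1, which is only used on a null set. *)
Definition line1_integral (R : realType) (Z : R[i] -> R[i]) (T delta : R) :
    \bar R :=
  (\int[lebesgue_measure]_(t in `[T, (T + delta)%R])
     (ComplexField.Normc.normc (Z (1 +i* t)%C))%:E)%E.

(* Main.v *)
Require Import Defs.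
From mathcomp Require Import all_boot all_order all_algebra.
From mathcomp Require Import complex.
From mathcomp Require Import all_classical all_reals all_analysis.
From mathcomp Require Import measurable_realfun.
From mathcomp Require Import ring lra.
Import Order.TTheory GRing.Theory Num.Theory.
Import numFieldNormedType.Exports.

Local Open Scope classical_set_scope.
Local Open Scope ring_scope.

(** Write alpha^s zeta(s, alpha) = 1 + sum_(n >= 1) exp (- lambda_n s) with
    lambda_n = ln (1 + n / alpha) > 0.  To bound the integral of its absolute
    value over a short interval from below, one wants an average over the
    interval that keeps the term n = 0 and damps all the others so much that
    their absolute values sum to less than 1.  Such averages are supplied by
    hyperbolic equations.  Multiply by exp (- i B t), which does not change
    absolute values and moves the frequencies to u_n = lambda_n + B, and solve
    the Klein-Gordon equation g_cc = g_tt + B^2 g with zero initial position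
    and with this function as initial velocity.  A frequency u is multiplied
    by sin (c nu) / nu, with nu^2 = u^2 - B^2 = lambda (lambda + 2 B).  For
    n = 0 one has nu = 0 and the factor is c, while for n >= 1 it is at most
    1 / nu in absolute value.  On the other hand g (c, t) only depends on the
    initial data in [t - c, t + c], and Gronwall's inequality for Duhamel's
    formula gives |g (c, t)| <= exp (B c) / 2 * int |initial velocity|
    ([kg_bound]).

    The decay 1 / nu is not enough, as sum 1 / (n ln n) diverges; three
    evolutions in a row ([trig_sum_le_of_prim]) lead to a sum comparable with
    sum 1 / (n (ln n)^(3/2)).  With c = delta / 6 and 2 B = 81 / delta^2 the
    damped terms sum to at most 39/40 of the first one
    ([log_weight_sum_le], [hurwitz_poly_lower_bound]), and the three rounds
    cost the factor exp (3 B c) = exp (81 / (4 delta)).  This gives the lower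
    bound alpha^-1 * delta / 240 * exp (- 81 / (4 delta)), which exceeds
    alpha^-1 * 10^(- 9 / delta) because 9 ln 10 > 81/4 and delta <= 1/20
    ([powR10_le_expR]); the remaining factor of the theorem is at most 1.

    All this is done for finite sums, where everything is elementary: the
    hypothesis is a bound for the increments of an explicit primitive, and
    integrals are replaced by the mean value theorem.  If the interval avoids
    the pole, zeta on the line is a uniform limit of such sums taken at
    sigma > 1 ([hurwitz_partial_unif], [zeta_near_line]).  If it contains the
    pole the integral is infinite: comparing the imaginary part of the series
    with an integral shows that |zeta (1 + i t, alpha)| >= 1 / (4 |t|) for
    small t ([zeta_pole_lower_bound]). *)

(** * Increments and derivatives *)

Lemma is_derive_sum_fun {R : realType} n (h : 'I_n -> R -> R) (dh : 'I_n -> R)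
    (x : R) :
  (forall i, is_derive x 1 (h i) (dh i)) ->
  is_derive x 1 (fun y => \sum_(i < n) h i y) (\sum_(i < n) dh i).
Proof.
move=> dh'; have -> : (fun y => \sum_(i < n) h i y) = \sum_(i < n) h i.
  by apply/funext => y; rewrite fct_sumE.
exact: is_derive_sum.
Qed.

Lemma is_derive_continuous_at {R : realType} (f : R -> R) (d x : R) :
  is_derive x 1 f d -> {for x, continuous f}.
Proof.
move=> h; apply: differentiable_continuous; apply/derivable1_diffP.
exact: (@ex_derive _ _ _ _ _ _ _ h).
Qed.

Lemma is_derive_continuous_within {R : realType} (f df : R -> R) (a b : R) :
  (forall x, a <= x <= b -> is_derive x 1 f (df x)) ->
  {within `[a, b], continuous f}.
Proof.
move=> hf; apply: continuous_in_subspaceT => x; rewrite inE /= in_itv /= => xab.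
exact: is_derive_continuous_at (hf x xab).
Qed.

Lemma is_derive_nondecreasing {R : realType} (f df : R -> R) (a b : R) :
  a <= b -> (forall x, a <= x <= b -> is_derive x 1 f (df x)) ->
  (forall x, a <= x <= b -> 0 <= df x) -> f a <= f b.
Proof.
move=> ab hf f0.
have [x xab e] : exists2 x, x \in `[a, b] & f b - f a = df x * (b - a).
  apply: MVT_segment => //; last exact: is_derive_continuous_within hf.
  by move=> x; rewrite in_itv /= => /andP[ax xb]; apply: hf; rewrite !ltW.
move: xab; rewrite in_itv /= => xab.
by rewrite -subr_ge0 e mulr_ge0 ?subr_ge0 ?f0.
Qed.

(** The inequality |int df| <= int dq without integrals: it follows from the
    monotonicity of q + f and of q - f. *)
Lemma le_increment {R : realType} (f df q dq : R -> R) (a b : R) : a <= b ->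
  (forall x, a <= x <= b -> is_derive x 1 f (df x)) ->
  (forall x, a <= x <= b -> is_derive x 1 q (dq x)) ->
  (forall x, a <= x <= b -> `|df x| <= dq x) -> `|f b - f a| <= q b - q a.
Proof.
move=> ab hf hq hfq; rewrite ler_norml; apply/andP; split.
  have := @is_derive_nondecreasing _ (fun x => f x + q x)
    (fun x => df x + dq x) a b ab (fun x h => is_deriveD (hf x h) (hq x h)) _.
  move=> h; suff : f a + q a <= f b + q b by lra.
  by apply: h => x /hfq; rewrite ler_norml; lra.
have := @is_derive_nondecreasing _ (fun x => q x - f x)
  (fun x => dq x - df x) a b ab (fun x h => is_deriveB (hq x h) (hf x h)) _.
move=> h; suff : q a - f a <= q b - f b by lra.
by apply: h => x /hfq; rewrite ler_norml; lra.
Qed.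

(** * Klein-Gordon evolution of trigonometric sums *)

(** The solution of y'' = - nu^2 y, y(0) = 0, y'(0) = 1, as a function of the
    time c; at nu = 0 it is the limit of sin (nu c) / nu. *)
Definition kg_mode {R : realType} (nu c : R) : R :=
  if nu == 0 then c else sin (nu * c) / nu.

Lemma is_derive_kg_mode {R : realType} (nu c : R) :
  is_derive c 1 (kg_mode nu) (cos (nu * c)).
Proof.
rewrite /kg_mode; case: eqVneq => [->|nu0].
  rewrite mul0r cos0; exact: is_derive_id.
by apply: is_derive_eq; rewrite /GRing.scale /=; field.
Qed.

Lemma is_derive_cos_kg_mode {R : realType} (nu c : R) :
  is_derive c 1 (fun c => cos (nu * c)) (- nu ^+ 2 * kg_mode nu c).
Proof.
apply: is_derive_eq; rewrite /GRing.scale /= /kg_mode.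
by case: eqVneq => [->|nu0]; [ring|field].
Qed.

Definition trig_sum {R : realType} {n} (p u : 'I_n -> R) (th t : R) : R :=
  \sum_(i < n) p i * cos (u i * t + th).

Definition trig_prim {R : realType} {n} (p u : 'I_n -> R) (th t : R) : R :=
  \sum_(i < n) p i / u i * sin (u i * t + th).

Lemma is_derive_trig_prim {R : realType} {n} (p u : 'I_n -> R) (th t : R) :
  (forall i, u i != 0) -> is_derive t 1 (trig_prim p u th) (trig_sum p u th t).
Proof.
move=> u0; apply: is_derive_sum_fun => i; have ui := u0 i.
by apply: is_derive_eq; rewrite /GRing.scale /=; field.
Qed.

Lemma trig_prim_increment {R : realType} {n} (p u : 'I_n -> R) (M th a b : R) :
  (forall i, u i != 0) -> a <= b ->
  (forall t, a <= t <= b -> `|trig_sum p u th t| <= M) ->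
  `|trig_prim p u th b - trig_prim p u th a| <= M * (b - a).
Proof.
move=> u0 ab hM; rewrite mulrBr.
apply: (@le_increment _ _ (trig_sum p u th) (fun x => M * x) (fun=> M)) => // x _.
  exact: is_derive_trig_prim.
by apply: is_derive_eq; rewrite /GRing.scale /=; ring.
Qed.

(** Duhamel's formula.  With u^2 = nu^2 + B^2, the function
    g(tau, y) = sum p kg_mode(nu, tau) cos (u y + th) solves the Klein-Gordon
    equation g_tautau = g_yy + B^2 g with g(0, .) = 0 and g_tau(0, .) equal to
    the trigonometric sum.  The sum differentiated here is d'Alembert's formula
    at (c, t) for the data of g at time tau: it is g(c, t) at tau = c, half an
    increment of the primitive at tau = 0, and its derivative in tau only
    involves g(tau, .) on the base [t - (c - tau), t + (c - tau)] of the
    backward light cone. *)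
Lemma is_derive_duhamel {R : realType} {n} (p u nu : 'I_n -> R)
    (B c t th tau : R) :
  (forall i, u i != 0) -> (forall i, u i ^+ 2 = nu i ^+ 2 + B ^+ 2) ->
  is_derive tau 1
    (fun tau => \sum_(i < n) p i * cos (u i * t + th) *
       (cos (nu i * tau) * (sin (u i * (c - tau)) / u i)
        + kg_mode (nu i) tau * cos (u i * (c - tau))))
    (B ^+ 2 / 2 *
       (trig_prim (fun i => p i * kg_mode (nu i) tau) u th (t + (c - tau))
        - trig_prim (fun i => p i * kg_mode (nu i) tau) u th (t - (c - tau)))).
Proof.
move=> u0 uB.
have -> : B ^+ 2 / 2 *
       (trig_prim (fun i => p i * kg_mode (nu i) tau) u th (t + (c - tau))
        - trig_prim (fun i => p i * kg_mode (nu i) tau) u th (t - (c - tau))) =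
   \sum_(i < n) p i * cos (u i * t + th) *
      (B ^+ 2 * kg_mode (nu i) tau * sin (u i * (c - tau)) / u i).
  rewrite /trig_prim -sumrB mulr_sumr; apply: eq_bigr => i _.
  have -> : u i * (t + (c - tau)) + th = (u i * t + th) + u i * (c - tau).
    by ring.
  have -> : u i * (t - (c - tau)) + th = (u i * t + th) - u i * (c - tau).
    by ring.
  by rewrite sinD sinB; have ui := u0 i; field.
apply: is_derive_sum_fun => i; have ui := u0 i.
have d1 := is_derive_kg_mode (nu i) tau; have d2 := is_derive_cos_kg_mode (nu i) tau.
have -> : B ^+ 2 = u i ^+ 2 - nu i ^+ 2 by rewrite uB addrAC subrr add0r.
apply: is_derive_eq; rewrite /GRing.scale /=.
by field.
Qed.

(** A bound of g in the whole backward cone improves under Duhamel's formula: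
    the term A / 2 * exp (B tau) is reproduced, since
    1 + B^2 * int_0^c (c - tau) exp (B tau) dtau <= exp (B c), whereas the
    excess X * exp (2 B tau), growing twice as fast, is divided by 4. *)
Lemma kg_picard {R : realType} {n} (p u nu : 'I_n -> R) (B l r A X c t th : R) :
  0 < B -> 0 <= X -> (forall i, u i != 0) ->
  (forall i, u i ^+ 2 = nu i ^+ 2 + B ^+ 2) ->
  (forall th a b, l <= a -> a <= b -> b <= r ->
     `|trig_prim p u th b - trig_prim p u th a| <= A) ->
  (forall tau y, 0 <= tau <= c -> l + tau <= y <= r - tau ->
     `|trig_sum (fun i => p i * kg_mode (nu i) tau) u th y|
       <= A / 2 * expR (B * tau) + X * expR (2 * B * tau)) ->
  0 <= c -> l + c <= t <= r - c ->
  `|trig_sum (fun i => p i * kg_mode (nu i) c) u th t|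
    <= A / 2 * expR (B * c) + X / 4 * expR (2 * B * c).
Proof.
move=> B0 X0 u0 uB hA hm c0 /andP[lt tr].
pose H tau := \sum_(i < n) p i * cos (u i * t + th) *
       (cos (nu i * tau) * (sin (u i * (c - tau)) / u i)
        + kg_mode (nu i) tau * cos (u i * (c - tau))).
(* [q] is a primitive of [dq], the Duhamel source for the assumed bound. *)
pose q tau := A / 2 * (B * (c - tau) + 1) * expR (B * tau)
   + X / 4 * (2 * B * (c - tau) + 1) * expR (2 * B * tau).
pose dq tau := B ^+ 2 * (c - tau) *
   (A / 2 * expR (B * tau) + X * expR (2 * B * tau)).
have kg0 i : kg_mode (nu i) 0 = 0.
  by rewrite /kg_mode mulr0 sin0 mul0r; case: ifP.
have Hc : H c = trig_sum (fun i => p i * kg_mode (nu i) c) u th t.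
  apply: eq_bigr => i _; rewrite subrr mulr0 sin0 cos0 mul0r; ring.
have H0 : H 0 = (trig_prim p u th (t + c) - trig_prim p u th (t - c)) / 2.
  rewrite /H /trig_prim -sumrB mulr_suml; apply: eq_bigr => i _.
  rewrite kg0 subr0 mulr0 cos0.
  have -> : u i * (t + c) + th = (u i * t + th) + u i * c by ring.
  have -> : u i * (t - c) + th = (u i * t + th) - u i * c by ring.
  by rewrite sinD sinB; have ui := u0 i; field.
have H0A : `|H 0| <= A / 2.
  rewrite H0 normrM [`|2^-1|]gtr0_norm ?invr_gt0 // ler_wpM2r ?invr_ge0 //.
  by apply: hA; lra.
have : `|H c - H 0| <= q c - q 0.
  have dH tau := @is_derive_duhamel _ _ p u nu B c t th tau u0 uB.
  apply: (le_increment H _ q dq 0 c c0 (fun x _ => dH x)) => tau /andP[tau0 tauc].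
    by apply: is_derive_eq; rewrite /GRing.scale /= /dq; field.
  have ct : 0 <= c - tau by lra.
  rewrite normrM ger0_norm; last by rewrite divr_ge0 // sqr_ge0.
  have := @trig_prim_increment _ _ (fun i => p i * kg_mode (nu i) tau) u
    (A / 2 * expR (B * tau) + X * expR (2 * B * tau)) th
    (t - (c - tau)) (t + (c - tau)) u0.
  move=> /(_ _)/(_ _) h.
  apply: (@le_trans _ _ (B ^+ 2 / 2 *
    ((A / 2 * expR (B * tau) + X * expR (2 * B * tau)) *
     (t + (c - tau) - (t - (c - tau)))))).
    rewrite ler_wpM2l ?divr_ge0 ?sqr_ge0 //; apply: h; first by lra.
    by move=> y hy; apply: hm; lra.
  by rewrite /dq le_eqVlt; apply/orP; left; apply/eqP; field.
rewrite Hc => h1.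
have q0 : q 0 = A / 2 * (B * c + 1) + X / 4 * (2 * B * c + 1).
  by rewrite /q !mulr0 expR0 subr0 !mulr1.
have qc : q c = A / 2 * expR (B * c) + X / 4 * expR (2 * B * c).
  by rewrite /q subrr !mulr0 add0r !mulr1.
have A0 : 0 <= A by move: (normr_ge0 (H 0)); lra.
have hB : 0 <= B * c by rewrite mulr_ge0 // ltW.
have AB : 0 <= A * (B * c) by rewrite mulr_ge0.
have XB : 0 <= X * (B * c) by rewrite mulr_ge0.
have := ler_normD (H c - H 0) (H 0); rewrite subrK Hc => h2.
by lra.
Qed.

Lemma le_of_quarter_pow {R : realType} (x a b : R) :
  (forall J : nat, x <= a + b / 4 ^+ J) -> x <= a.
Proof.
move=> h; rewrite leNgt; apply/negP => ax.
have J4 (J : nat) : J.+1%:R <= 4 ^+ J :> R.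
  elim: J => [|J IH]; first by rewrite expr0.
  rewrite exprS; move: (ler0n R J) IH; rewrite -[J.+2]addn1 -[J.+1]addn1 !natrD.
  by lra.
have b0 : 0 < b by have := h 0; rewrite expr0 divr1; lra.
have xa : 0 < x - a by rewrite subr_gt0.
have [J hJ] : exists J : nat, b / (x - a) < J.+1%:R.
  exists (Num.trunc (b / (x - a))).
  by apply: truncnS_gt; rewrite divr_ge0 // ltW.
have := h J; apply/negP; rewrite -ltNge -ltrBrDl ltr_pdivrMr ?exprn_gt0 //.
rewrite mulrC -ltr_pdivrMr //; exact: lt_le_trans hJ (J4 J).
Qed.

Lemma normr_kg_mode_le {R : realType} (nu c : R) :
  0 <= c -> `|kg_mode nu c| <= `|nu|^-1 + c.
Proof.
move=> c0; rewrite /kg_mode; case: eqVneq => [_|nu0].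
  by rewrite ger0_norm // lerDr invr_ge0.
rewrite normrM normfV -[leLHS]addr0 lerD // -[leRHS]mul1r ler_wpM2r ?invr_ge0 //.
by rewrite ler_norml sin_geN1 sin_le1.
Qed.

(** Finite speed of propagation: the value at (c, t) is controlled by integrals
    of the initial velocity over subintervals of [t - c, t + c] only.  The
    crude bound [X], which uses the coefficients, disappears in the limit of
    the iteration of [kg_picard]; the final bound does not depend on [p]. *)
Lemma kg_bound {R : realType} {n} (p u nu : 'I_n -> R) (B l r A : R) :
  0 < B -> (forall i, u i != 0) ->
  (forall i, u i ^+ 2 = nu i ^+ 2 + B ^+ 2) ->
  (forall th a b, l <= a -> a <= b -> b <= r ->
     `|trig_prim p u th b - trig_prim p u th a| <= A) ->
  forall c t th, 0 <= c -> l + c <= t <= r - c ->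
  `|trig_sum (fun i => p i * kg_mode (nu i) c) u th t| <= A / 2 * expR (B * c).
Proof.
move=> B0 u0 uB hA.
pose X := \sum_(i < n) `|p i| * (`|nu i|^-1 + `|r - l|).
have X0 : 0 <= X.
  by apply: sumr_ge0 => i _; rewrite mulr_ge0 // addr_ge0 // invr_ge0.
suff h J : forall c t th, 0 <= c -> l + c <= t <= r - c ->
    `|trig_sum (fun i => p i * kg_mode (nu i) c) u th t|
      <= A / 2 * expR (B * c) + X / 4 ^+ J * expR (2 * B * c).
  move=> c t th c0 ct.
  apply: (@le_of_quarter_pow _ _ _ (X * expR (2 * B * c))) => J.
  by rewrite [X * _ / _]mulrAC; exact: h.
elim: J => [|J IH] c t th c0 ct.
  have A0 : 0 <= A.
    by apply: le_trans (hA 0 t t _ _ _) => //; lra.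
  rewrite expr0 divr1 -[leLHS]add0r lerD //.
    by rewrite mulr_ge0 ?expR_ge0 // divr_ge0.
  apply: (@le_trans _ _ X); last first.
    have := expR_ge1Dx (2 * B * c); have : 0 <= B * c by rewrite mulr_ge0 // ltW.
    by move=> Bc h; rewrite ler_peMr //; lra.
  rewrite /trig_sum; apply: le_trans (ler_norm_sum _ _ _) _.
  apply: ler_sum => i _; rewrite !normrM -[leRHS]mulr1 ler_pM //.
    rewrite ler_wpM2l //; apply: le_trans (normr_kg_mode_le _ _ c0) _.
    by rewrite lerD2l ger0_norm; lra.
  by rewrite ler_norml cos_geN1 cos_le1.
rewrite exprSr invfM mulrA.
apply: (@kg_picard _ _ p u nu B l r A (X / 4 ^+ J)) => //.
  by rewrite divr_ge0 // exprn_ge0.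
by move=> tau y /andP[tau0 _] hy; exact: IH.
Qed.

(** Three evolutions in a row, each of duration [c], consume the interval of
    length 6 c and multiply each coefficient by kg_mode (nu, c)^3.  Between two
    rounds the sup norm bound is turned back into a bound of increments, which
    only costs the length of the remaining interval. *)
Lemma trig_sum_le_of_prim {R : realType} {n} (p u nu : 'I_n -> R) (B T c A : R) :
  0 < B -> 0 < c -> (forall i, u i != 0) ->
  (forall i, u i ^+ 2 = nu i ^+ 2 + B ^+ 2) ->
  (forall th a b, T <= a -> a <= b -> b <= T + 6 * c ->
     `|trig_prim p u th b - trig_prim p u th a| <= A) ->
  forall th, `|trig_sum (fun i => p i * kg_mode (nu i) c ^+ 3) u th (T + 3 * c)|
     <= c ^+ 2 * A * expR (3 * (B * c)).
Proof.
move=> B0 c0 u0 uB hA.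
have step q M l r : (forall th a b, l <= a -> a <= b -> b <= r ->
      `|trig_prim q u th b - trig_prim q u th a| <= M) -> l + c <= r - c ->
    forall th a b, l + c <= a -> a <= b -> b <= r - c ->
      `|trig_prim (fun i => q i * kg_mode (nu i) c) u th b
        - trig_prim (fun i => q i * kg_mode (nu i) c) u th a|
         <= M / 2 * expR (B * c) * (r - l - 2 * c).
  move=> hq lr th a b la ab br.
  have M0 : 0 <= M by apply: le_trans (hq 0 l l _ _ _) => //; lra.
  have Me : 0 <= M / 2 * expR (B * c) by rewrite mulr_ge0 ?expR_ge0 ?divr_ge0.
  apply: (@le_trans _ _ (M / 2 * expR (B * c) * (b - a))).
    apply: trig_prim_increment => // t ht.
    by apply: (@kg_bound _ _ q u nu B l r) => //; lra.
  by rewrite ler_wpM2l //; lra.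
have lr1 : T + c <= T + 6 * c - c by lra.
have lr2 : T + c + c <= T + 6 * c - c - c by lra.
have h3 := kg_bound _ u nu B _ _ _ B0 u0 uB (step _ _ _ _ (step _ _ _ _ hA lr1) lr2).
move=> th; rewrite (expRM_natl 3).
have -> : (fun i => p i * kg_mode (nu i) c ^+ 3) =
  (fun i => p i * kg_mode (nu i) c * kg_mode (nu i) c * kg_mode (nu i) c).
  by apply/funext => i; ring.
have h4 := h3 c (T + 3 * c) th (ltW c0) _.
apply: (le_trans (h4 _)); first lra.
rewrite le_eqVlt; apply/orP; left; apply/eqP; by field.
Qed.

(** * Numerical constants *)

Lemma expR1_le {R : realType} : expR 1 <= 272 / 100 :> R.
Proof.
(* exp x <= (2 + x) / (2 - x), used at x = 1/16 and then squared four times. *)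
have pade (x : R) : 0 <= x -> expR x * (2 - x) <= 2 + x.
  move=> x0; rewrite -subr_ge0.
  pose f y : R := 2 + y - expR y * (2 - y).
  have -> : 0 = f 0 by rewrite /f expR0; ring.
  apply: (is_derive_nondecreasing f (fun y => 1 - expR y * (1 - y))) => // y _.
    by apply: is_derive_eq; rewrite /GRing.scale /=; ring.
  have := expR_ge1Dx (- y); rewrite expRN => h.
  by rewrite subr_ge0 mulrC -ler_pdivlMr ?expR_gt0 // mul1r.
have -> : expR 1 = expR (16%:R * (1 / 16)) :> R by congr expR; field.
rewrite expRM_natl.
have sq (x q q' : R) : 0 <= x -> x <= q -> q * q <= q' -> x * x <= q'.
  move=> x0 xq; apply: le_trans; exact: ler_pM.
set x := expR _; have x0 : 0 <= x by exact: expR_ge0.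
have h16 : 0 <= 1 / 16 :> R by lra.
have x1 : x <= 33 / 31 by have := pade _ h16; rewrite -/x; lra.
have x2 : x * x <= 2833 / 2500.
  by apply: (sq _ _ _ x0 x1); lra.
have x4 : (x * x) * (x * x) <= 122 / 95.
  by apply: (sq _ _ _ _ x2); [exact: mulr_ge0|lra].
have x8 : (x * x) * (x * x) * ((x * x) * (x * x)) <= 315 / 191.
  by apply: (sq _ _ _ _ x4); [rewrite !mulr_ge0|lra].
have -> : x ^+ 16 =
   (x * x) * (x * x) * ((x * x) * (x * x)) *
   ((x * x) * (x * x) * ((x * x) * (x * x))) by ring.
by apply: (sq _ _ _ _ x8); [rewrite !mulr_ge0|lra].
Qed.

(** 11/16 is below ln 2 because e^11 < 2^16. *)
Lemma ln2_ge {R : realType} : 11 / 16 <= ln 2 :> R.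
Proof.
have e := @expR1_le R.
have -> : 11 / 16 = ln (expR (11 / 16)) :> R by rewrite expRK.
rewrite ler_ln ?posrE ?expR_gt0 //.
rewrite -(@ler_pXn2r _ 16) ?nnegrE ?expR_ge0 //.
rewrite -expRM_natl.
have -> : 16 * (11 / 16) = 11%:R * 1 :> R by field.
rewrite expRM_natl.
apply: (@le_trans _ _ ((272 / 100) ^+ 11)).
  by apply: lerXn2r; rewrite ?nnegrE ?expR_ge0; lra.
lra.
Qed.

(** 23/10 is below ln 10 because e^23 < 10^10. *)
Lemma ln10_ge {R : realType} : 23 / 10 <= ln 10 :> R.
Proof.
have e := @expR1_le R.
have -> : 23 / 10 = ln (expR (23 / 10)) :> R by rewrite expRK.
rewrite ler_ln ?posrE ?expR_gt0 //.
rewrite -(@ler_pXn2r _ 10) ?nnegrE ?expR_ge0 //.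
rewrite -expRM_natl.
have -> : 10 * (23 / 10) = 23%:R * 1 :> R by field.
rewrite expRM_natl.
apply: (@le_trans _ _ ((272 / 100) ^+ 23)).
  by apply: lerXn2r; rewrite ?nnegrE ?expR_ge0; lra.
lra.
Qed.

Lemma expR9_ge {R : realType} : 4800 <= expR 9 :> R.
Proof.
have -> : 9 = 72%:R * (1 / 8) :> R by field.
rewrite expRM_natl.
apply: (@le_trans _ _ ((9 / 8) ^+ 72)).
  lra.
rewrite ler_pXn2r ?nnegrE ?expR_ge0 //.
by have := expR_ge1Dx (1 / 8 : R); lra.
Qed.

(** * Hurwitz frequencies *)

(** The frequencies of alpha^s zeta(s, alpha) = sum exp (- s lambda_n); the
    first one is 0. *)
Definition log_ratio {R : realType} (alpha : R) (n : nat) : R :=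
  ln (n%:R + alpha) - ln alpha.

Lemma log_ratio0 {R : realType} (alpha : R) : log_ratio alpha 0 = 0.
Proof. by rewrite /log_ratio add0r subrr. Qed.

Lemma log_ratio_incr {R : realType} (alpha : R) n : 0 < alpha ->
  (n.+1%:R + alpha)^-1 <= log_ratio alpha n.+1 - log_ratio alpha n.
Proof.
move=> a0.
have n0 : 0 < n%:R + alpha by rewrite ltr_wpDl.
have n1 : 0 < n.+1%:R + alpha by rewrite ltr_wpDl.
have -> : log_ratio alpha n.+1 - log_ratio alpha n =
    - ln ((n%:R + alpha) / (n.+1%:R + alpha)).
  by rewrite ln_div ?posrE // /log_ratio; ring.
have := expR_ge1Dx (ln ((n%:R + alpha) / (n.+1%:R + alpha))).
rewrite lnK ?posrE ?divr_gt0 // => h.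
have e : 1 - (n%:R + alpha) / (n.+1%:R + alpha) = (n.+1%:R + alpha)^-1.
  move: n1; rewrite -natr1 => n1; field; lra.
by lra.
Qed.

Lemma log_ratio_le {R : realType} (alpha : R) m n : 0 < alpha -> (m <= n)%N ->
  log_ratio alpha m <= log_ratio alpha n.
Proof.
move=> a0 mn; rewrite /log_ratio lerD2r ler_ln ?posrE ?ltr_wpDl //.
by rewrite lerD2r ler_nat.
Qed.

Lemma log_ratio1_ge {R : realType} (alpha : R) : 0 < alpha -> alpha <= 1 ->
  11 / 16 <= log_ratio alpha 1.
Proof.
move=> a0 a1; apply: le_trans ln2_ge _.
rewrite /log_ratio -ln_div ?posrE // ?addr_gt0 // ler_ln ?posrE ?divr_gt0 ?addr_gt0 //.
by rewrite ler_pdivlMr //; lra.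
Qed.

(** With e <= b^2 - a^2 this is the comparison of a sum with the integral of
    x^(-3/2), in the variable x = b^2. *)
Lemma inv_telescope {R : realType} (a b e : R) : 0 < a -> a <= b -> 0 <= e ->
  e <= b ^+ 2 - a ^+ 2 -> e / b ^+ 3 <= 2 / a - 2 / b.
Proof.
move=> a0 ab e0 eab; have b0 : 0 < b by exact: lt_le_trans ab.
have -> : 2 / a - 2 / b = 2 * (b - a) / (a * b) by field; lra.
rewrite ler_pdivrMr ?exprn_gt0 // mulrAC ler_pdivlMr ?mulr_gt0 //.
have h1 : e * (a * b) <= (b ^+ 2 - a ^+ 2) * (a * b).
  by rewrite ler_wpM2r // ltW // mulr_gt0.
apply: le_trans h1 _; rewrite -subr_ge0.
have -> : 2 * (b - a) * b ^+ 3 - (b ^+ 2 - a ^+ 2) * (a * b) =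
   (b - a) * b * ((b ^+ 2 - a * b) + (b ^+ 2 - a ^+ 2)) by ring.
have h2 : 0 <= b ^+ 2 - a * b by rewrite expr2 -mulrBl mulr_ge0 ?subr_ge0 // ltW.
have h3 : 0 <= b ^+ 2 - a ^+ 2 by exact: le_trans eab.
apply: mulr_ge0; last exact: addr_ge0.
by rewrite mulr_ge0 ?subr_ge0 // ltW.
Qed.

(** The weights alpha / (n + alpha) are at most the gaps of the frequencies
    lambda_n, so that from the second term on the sum is at most the integral
    of x^(-3/2) from lambda_1.  As lambda_1 >= ln 2 >= 11/16, the total is at
    most 1/2 * k^(-3) + 2 / k for k = 0.829, whose square is below 11/16; the
    right-hand side is chosen to be cancelled by the factor 8/27 of
    [normr_kg_mode_sqrt_le]. *)
Lemma log_weight_sum_le {R : realType} (alpha : R) N : 0 < alpha -> alpha <= 1 ->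
  \sum_(i < N) alpha / (i.+1%:R + alpha) / Num.sqrt (log_ratio alpha i.+1) ^+ 3
    <= 27 / 8 * (39 / 40).
Proof.
move=> a0 a1; pose y n := Num.sqrt (log_ratio alpha n).
have l1 := @log_ratio1_ge _ alpha a0 a1.
have [k kE] : {k : R | k = 829 / 1000} by exists (829 / 1000).
have k0 : 0 < k by rewrite kE; lra.
have k2 : k ^+ 2 <= log_ratio alpha 1 by apply: le_trans l1; rewrite kE; lra.
have y1 : k <= y 1%N.
  by rewrite -(ger0_norm (ltW k0)) -sqrtr_sqr ler_wsqrtr.
have yS n : k <= y n.+1.
  by apply: le_trans y1 _; rewrite ler_wsqrtr //; exact: log_ratio_le.
have y0 n : 0 < y n.+1 by exact: lt_le_trans (yS n).
have y2 n : y n.+1 ^+ 2 = log_ratio alpha n.+1.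
  rewrite sqr_sqrtr //; apply: le_trans (log_ratio_le _ 1 n.+1 a0 isT).
  by apply: le_trans k2; rewrite sqr_ge0.
have iy1 : (y 1%N)^-1 <= k^-1 by rewrite lef_pV2 ?posrE.
have iy0 n : 0 < (y n.+1)^-1 by rewrite invr_gt0.
have w1 : alpha / (1 + alpha) <= 1 / 2 by rewrite ler_pdivrMr; lra.
have first : alpha / (1 + alpha) / y 1%N ^+ 3 <= 1 / 2 * k^-1 ^+ 3.
  rewrite -exprVn; apply: ler_pM => //.
  - by rewrite divr_ge0 // ?addr_ge0 // ltW.
  - by rewrite exprn_ge0 // ltW.
  - by rewrite lerXn2r // nnegrE ltW // invr_gt0.
have total : 1 / 2 * k^-1 ^+ 3 + 2 * k^-1 <= 27 / 8 * (39 / 40).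
  by rewrite kE; lra.
suff h : \sum_(i < N.+1) alpha / (i.+1%:R + alpha) / y i.+1 ^+ 3
    <= alpha / (1 + alpha) / y 1%N ^+ 3 + 2 / y 1%N - 2 / y N.+1.
  move: h; rewrite big_ord_recr /= => h.
  have p0 : 0 <= alpha / (N.+1%:R + alpha) / y N.+1 ^+ 3.
    by rewrite !mulr_ge0 ?invr_ge0 ?exprn_ge0 ?addr_ge0 // ltW.
  have := iy0 N. rewrite -/y; lra.
elim: N => [|N IH]; first by rewrite big_ord1 addrK.
rewrite big_ord_recr /=.
have := @inv_telescope _ (y N.+1) (y N.+2) (N.+2%:R + alpha)^-1 (y0 _) _ _ _.
move=> /(_ _)/(_ _)/(_ _) h.
have n2 : 0 < N.+2%:R + alpha by rewrite ltr_wpDl.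
have : (N.+2%:R + alpha)^-1 / y N.+2 ^+ 3 <= 2 / y N.+1 - 2 / y N.+2.
  apply: h; first by rewrite ler_wsqrtr // log_ratio_le.
    by rewrite invr_ge0 ltW.
  by rewrite !y2 log_ratio_incr.
have : alpha / (N.+2%:R + alpha) / y N.+2 ^+ 3 <= (N.+2%:R + alpha)^-1 / y N.+2 ^+ 3.
  rewrite -mulrA ler_piMl // mulr_ge0 // invr_ge0 ?exprn_ge0 // ltW //.
by lra.
Qed.

(** Here nu^2 = lam (lam + 2 B) with 2 B = 81 / delta^2, and the evolution
    time is c = delta / 6: then (nu c)^2 >= 9/4 lam, and |sin| <= 1 gives the
    decay |kg_mode / c| <= 2 / (3 sqrt lam). *)
Lemma normr_kg_mode_sqrt_le {R : realType} (lam delta : R) : 0 < lam -> 0 < delta ->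
  `|kg_mode (Num.sqrt (lam * (lam + 81 / delta ^+ 2))) (delta / 6)|
    <= delta / 6 * (2 / 3) / Num.sqrt lam.
Proof.
move=> lam0 d0; set c := delta / 6.
have c0 : 0 < c by rewrite divr_gt0.
set nu := Num.sqrt (lam * _).
have y0 : 0 < Num.sqrt lam by rewrite sqrtr_gt0.
have B0 : 0 < 81 / delta ^+ 2 by rewrite divr_gt0 // exprn_gt0.
have nu0 : 0 < nu by rewrite sqrtr_gt0 mulr_gt0 // addr_gt0.
have nuc : 3 / 2 * Num.sqrt lam <= nu * c.
  rewrite -(@ler_pXn2r _ 2) ?nnegrE ?mulr_ge0 ?(ltW c0) ?(ltW d0) ?sqrtr_ge0 //.
  have -> : (3 / 2 * Num.sqrt lam) ^+ 2 = lam * (81 / delta ^+ 2) * c ^+ 2.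
    by rewrite exprMn sqr_sqrtr ?(ltW lam0) // /c; field; lra.
  rewrite [leRHS]exprMn sqr_sqrtr; last by rewrite ltW // mulr_gt0 // addr_gt0.
  by rewrite ler_wpM2r ?sqr_ge0 // ler_wpM2l ?(ltW lam0) // lerDr ltW.
rewrite /kg_mode. rewrite gt_eqF // normrM normfV (gtr0_norm nu0).
apply: (@le_trans _ _ nu^-1).
  rewrite -[leRHS]mul1r ler_wpM2r ?invr_ge0 ?(ltW nu0) //.
  by rewrite ler_norml sin_geN1 sin_le1.
rewrite ler_pdivlMr // mulrC ler_pdivrMr //; lra.
Qed.

Lemma hurwitz_coeff_le {R : realType} (alpha sigma : R) n :
  0 < alpha -> 1 <= sigma ->
  expR (- sigma * ln (n%:R + alpha)) <=
  expR (- sigma * ln alpha) * (alpha / (n%:R + alpha)).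
Proof.
move=> a0 s1; have n0 : 0 < n%:R + alpha by rewrite ltr_wpDl.
have -> : alpha / (n%:R + alpha) = expR (- log_ratio alpha n).
  by rewrite /log_ratio opprB expRB !lnK.
rewrite -expRD ler_expR /log_ratio.
have l0 : 0 <= log_ratio alpha n by rewrite -(log_ratio0 alpha) log_ratio_le.
have : 0 <= (sigma - 1) * log_ratio alpha n by rewrite mulr_ge0 // subr_ge0.
rewrite /log_ratio; lra.
Qed.

(** After the three evolutions the term n = 0, whose nu vanishes, is multiplied
    by c^3, and the other terms together amount to at most 39/40 of it: they
    cannot cancel it.  The modulation of frequency B does not change the
    absolute values, but moves lambda_n to lambda_n + B, so that
    (lambda_n + B)^2 - B^2 vanishes for n = 0 only.  The constants are
    c / 40 = delta / 240 and 3 B c = 81 / (4 delta). *)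
Lemma hurwitz_poly_lower_bound {R : realType} (alpha delta sigma A T : R) N :
  0 < alpha -> alpha <= 1 -> 1 <= sigma -> 0 < delta ->
  (forall th a b, T <= a -> a <= b -> b <= T + delta ->
     `|trig_prim (fun i : 'I_N.+1 => expR (- sigma * ln (i%:R + alpha)))
         (fun i => log_ratio alpha i + 81 / (2 * delta ^+ 2)) th b
     - trig_prim (fun i : 'I_N.+1 => expR (- sigma * ln (i%:R + alpha)))
         (fun i => log_ratio alpha i + 81 / (2 * delta ^+ 2)) th a| <= A) ->
  expR (- sigma * ln alpha) * (delta / 240) <= A * expR (81 / (4 * delta)).
Proof.
move=> a0 a1 s1 d0.
set p := fun i : 'I_N.+1 => _; set u := fun i : 'I_N.+1 => _ => hA.
set B := 81 / (2 * delta ^+ 2).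
pose nu (i : 'I_N.+1) :=
  Num.sqrt (log_ratio alpha i * (log_ratio alpha i + 81 / delta ^+ 2)).
have B0 : 0 < B by rewrite divr_gt0 ?mulr_gt0 ?exprn_gt0.
have BB : 0 < 81 / delta ^+ 2 by rewrite divr_gt0 ?mulr_gt0 ?exprn_gt0.
have l0 n : 0 <= log_ratio alpha n by rewrite -(log_ratio0 alpha) log_ratio_le.
have u0 i : u i != 0 by rewrite gt_eqF // ltr_wpDl.
have uB i : u i ^+ 2 = nu i ^+ 2 + B ^+ 2.
  rewrite /nu sqr_sqrtr; last by rewrite mulr_ge0 // ler_wpDl // ltW.
  by rewrite /u /B; field; lra.
have hA' : forall th a b, T <= a -> a <= b -> b <= T + 6 * (delta / 6) ->
     `|trig_prim p u th b - trig_prim p u th a| <= A.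
  by move=> th a b ha hab hb; apply: hA => //; lra.
have c0 : 0 < delta / 6 by rewrite divr_gt0.
(* With this phase the term n = 0 is real and positive at the midpoint. *)
pose th := - (u ord0 * (T + 3 * (delta / 6))).
have := @trig_sum_le_of_prim _ _ p u nu B T (delta / 6) A B0 c0 u0 uB hA' th.
have -> : 3 * (B * (delta / 6)) = 81 / (4 * delta) by rewrite /B; field; lra.
rewrite /trig_sum big_ord_recl {1}/th subrr cos0 mulr1.
have -> : kg_mode (nu ord0) (delta / 6) = delta / 6.
  by rewrite /kg_mode /nu log_ratio0 mul0r sqrtr0 eqxx.
have -> : p ord0 = expR (- sigma * ln alpha) by rewrite /p /= add0r.
set p0 := expR (- sigma * ln alpha); set rest := \sum_(i < N) _; set c := delta / 6.
have p00 : 0 < p0 by exact: expR_gt0.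
have : `|rest| <= p0 * c ^+ 3 * (39 / 40).
  apply: (@le_trans _ _ (\sum_(i < N) p0 * c ^+ 3 * (8 / 27) *
     (alpha / (i.+1%:R + alpha) / Num.sqrt (log_ratio alpha i.+1) ^+ 3))).
    apply: le_trans (ler_norm_sum _ _ _) _; apply: ler_sum => i _.
    have li : 0 < log_ratio alpha i.+1.
      apply: lt_le_trans (log_ratio_le alpha 1 i.+1 a0 isT).
      by have := log_ratio1_ge alpha a0 a1; lra.
    have y0 : 0 < Num.sqrt (log_ratio alpha i.+1) by rewrite sqrtr_gt0.
    have -> : p0 * c ^+ 3 * (8 / 27) *
       (alpha / (i.+1%:R + alpha) / Num.sqrt (log_ratio alpha i.+1) ^+ 3) =
       p0 * (alpha / (i.+1%:R + alpha)) *
       (c * (2 / 3) / Num.sqrt (log_ratio alpha i.+1)) ^+ 3.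
      have n0 : 0 < i.+1%:R + alpha by rewrite ltr_wpDl.
      by field; rewrite (gt_eqF y0) -natr1 in n0 *; lra.
    rewrite normrM -[leRHS]mulr1; apply: ler_pM => //; last first.
      by rewrite ler_norml cos_geN1 cos_le1.
    rewrite normrM normrX; apply: ler_pM => //.
      rewrite gtr0_norm ?expR_gt0 //; exact: hurwitz_coeff_le.
    apply: lerXn2r; rewrite ?nnegrE //.
      by apply: divr_ge0; [apply: mulr_ge0; [exact: ltW|lra]|exact: ltW].
    exact: normr_kg_mode_sqrt_le.
  have pc : 0 < p0 * c ^+ 3 by rewrite mulr_gt0 // exprn_gt0.
  rewrite -mulr_sumr -[_ * (8 / 27) * _]mulrA (ler_pM2l pc).
  by have := @log_weight_sum_le _ alpha N a0 a1; lra.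
rewrite ler_norml => /andP[r1 r2]; rewrite ler_norml => /andP[_ h].
have h2 : c ^+ 2 * (p0 * (delta / 240)) <= c ^+ 2 * (A * expR (81 / (4 * delta))).
  have -> : c ^+ 2 * (p0 * (delta / 240)) = p0 * c ^+ 3 / 40 by rewrite /c; field.
  lra.
by move: h2; rewrite ler_pM2l // exprn_gt0.
Qed.

(** * Partial sums of the Dirichlet series *)

Local Notation cabs := ComplexField.Normc.normc.

Lemma cabsE {R : realType} (z : R[i]) :
  cabs z = Num.sqrt (complex.Re z ^+ 2 + complex.Im z ^+ 2).
Proof. by case: z. Qed.

Lemma cabs_ge0 {R : realType} (z : R[i]) : 0 <= cabs z.
Proof. by rewrite cabsE sqrtr_ge0. Qed.

Lemma normr_cabs {R : realType} (z : R[i]) : `|z| = (cabs z)%:C%C.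
Proof. by rewrite normc_def cabsE. Qed.

Lemma cabs_le_add {R : realType} (a b : R) : cabs (a +i* b)%C <= `|a| + `|b|.
Proof.
rewrite cabsE /= -[leRHS]ger0_norm ?addr_ge0 // -sqrtr_sqr ler_wsqrtr //.
rewrite -(real_normK (num_real a)) -(real_normK (num_real b)).
have : 0 <= `|a| * `|b| by rewrite mulr_ge0.
lra.
Qed.

Lemma ler_cabsD {R : realType} (z w : R[i]) : cabs (z + w) <= cabs z + cabs w.
Proof. by rewrite -lecR rmorphD /= -!normr_cabs ler_normD. Qed.

Lemma cabsN {R : realType} (z : R[i]) : cabs (- z) = cabs z.
Proof. by rewrite !cabsE; case: z => a b /=; rewrite !sqrrN. Qed.

Lemma rotated_re_le_cabs {R : realType} (phi : R) (w : R[i]) :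
  cos phi * complex.Re w + sin phi * complex.Im w <= cabs w.
Proof.
case: w => a b; rewrite cabsE /=.
apply: le_trans (ler_norm _) _; rewrite -sqrtr_sqr ler_wsqrtr //.
rewrite -subr_ge0; have := sqr_ge0 (cos phi * b - sin phi * a).
have -> : a ^+ 2 + b ^+ 2 - (cos phi * a + sin phi * b) ^+ 2 =
  (cos phi * b - sin phi * a) ^+ 2
  + (1 - (cos phi ^+ 2 + sin phi ^+ 2)) * (a ^+ 2 + b ^+ 2) by ring.
by rewrite cos2Dsin2 subrr mul0r addr0.
Qed.

Definition hurwitz_partial {R : realType} (alpha : R) (N : nat) (s : R[i]) : R[i] :=
  \sum_(0 <= n < N) cpow (n%:R + alpha) (- s).

Lemma cpow_line {R : realType} (x sigma t : R) :
  cpow x (- (sigma +i* t)%C) =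
  (expR (- sigma * ln x) * cos (t * ln x) +i*
   - (expR (- sigma * ln x) * sin (t * ln x)))%C.
Proof.
rewrite /cpow /= !mulNr cosN sinN.
by apply/eqP; rewrite eq_complex /= !mul0r subr0 addr0 mulrN !eqxx.
Qed.

Lemma Re_hurwitz_partial {R : realType} (alpha sigma t : R) N :
  complex.Re (hurwitz_partial alpha N (sigma +i* t)%C) =
  \sum_(0 <= n < N) expR (- sigma * ln (n%:R + alpha)) * cos (t * ln (n%:R + alpha)).
Proof.
rewrite /hurwitz_partial raddf_sum; apply: eq_bigr => n _.
by rewrite cpow_line.
Qed.

Lemma Im_hurwitz_partial {R : realType} (alpha sigma t : R) N :
  complex.Im (hurwitz_partial alpha N (sigma +i* t)%C) =
  - \sum_(0 <= n < N) expR (- sigma * ln (n%:R + alpha)) * sin (t * ln (n%:R + alpha)).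
Proof.
rewrite /hurwitz_partial raddf_sum -sumrN; apply: eq_bigr => n _.
by rewrite cpow_line.
Qed.

Lemma cabs_cpow_line {R : realType} (x sigma t : R) :
  cabs (cpow x (- (sigma +i* t)%C)) = expR (- sigma * ln x).
Proof.
rewrite cpow_line cabsE /= sqrrN !exprMn -mulrDr cos2Dsin2 mulr1 sqrtr_sqr.
by rewrite ger0_norm ?expR_ge0.
Qed.

Lemma cabs_sum_nat {R : realType} (F : nat -> R[i]) m n :
  cabs (\sum_(m <= i < n) F i) <= \sum_(m <= i < n) cabs (F i).
Proof.
elim/big_ind2 : _ => [|x a y b xa yb|//]; first by rewrite ComplexField.Normc.normc0.
exact: le_trans (ler_cabsD _ _) (lerD xa yb).
Qed.

Lemma cvg_cabs_lt {R : realType} (u : nat -> R[i]) (l : R[i]) (e : R) : 0 < e ->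
  (u : nat -> R[i]^o) @ \oo --> (l : R[i]^o) ->
  exists N, forall n, (N <= n)%N -> cabs (l - u n) < e.
Proof.
move=> e0 /cvgrPdist_lt /(_ (e%:C)%C).
rewrite ltcR => /(_ e0) [N _ h]; exists N => n /h /=.
by rewrite normr_cabs ltcR.
Qed.

(** The terms at sigma + i t have the absolute values of those at sigma, whose
    sum converges because the series is assumed to converge at the real point
    sigma: the truncation error is uniform in t. *)
Lemma hurwitz_partial_unif {R : realType} (alpha sigma e : R) (Z : R[i] -> R[i]) :
  is_hurwitz_zeta alpha Z -> 1 < sigma -> 0 < e ->
  exists N, forall t, cabs (Z (sigma +i* t)%C
    - hurwitz_partial alpha N.+1 (sigma +i* t)%C) <= e.
Proof.
move=> [hZ _] s1 e0.
have e4 : 0 < e / 4 by rewrite divr_gt0.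
have [N hN] := cvg_cabs_lt _ _ _ e4 (hZ (sigma +i* 0)%C s1).
exists N => t.
have [M hM] := cvg_cabs_lt _ _ _ e4 (hZ (sigma +i* t)%C s1).
pose K := maxn M N.+1.
have MK := hM _ (leq_maxl M N.+1); have NK := hN _ (leq_trans (leqnSn N) (leq_maxr M N.+1)).
have N1 := hN _ (leqnSn N).
rewrite -/K in MK NK.
have tail : \sum_(N.+1 <= n < K) expR (- sigma * ln (n%:R + alpha)) <= e / 2.
  set z := Z (sigma +i* 0)%C in NK N1.
  have h0 L : complex.Re (\sum_(0 <= n < L) cpow (n%:R + alpha) (- (sigma +i* 0)%C))
      = \sum_(0 <= n < L) expR (- sigma * ln (n%:R + alpha)).
    rewrite [LHS](Re_hurwitz_partial alpha sigma 0 L).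
    by apply: eq_bigr => n _; rewrite mul0r cos0 mulr1.
  have re (w : R[i]) : `|complex.Re w| <= cabs w.
    rewrite ler_norml; apply/andP; split.
      have := rotated_re_le_cabs pi w; rewrite cospi sinpi; lra.
    by have := rotated_re_le_cabs 0 w; rewrite cos0 sin0; lra.
  have := le_lt_trans (re _) NK; have := le_lt_trans (re _) N1.
  rewrite !raddfB /= !h0 [in X in _ -> X](@big_cat_nat _ _ _ N.+1 0 K) ?leq_maxr //=.
  rewrite !ltr_norml; lra.
have -> : Z (sigma +i* t)%C - hurwitz_partial alpha N.+1 (sigma +i* t)%C =
  (Z (sigma +i* t)%C - hurwitz_partial alpha K (sigma +i* t)%C) +
  \sum_(N.+1 <= n < K) cpow (n%:R + alpha) (- (sigma +i* t)%C).
  rewrite /hurwitz_partial (@big_cat_nat _ _ _ N.+1 0 K) ?leq_maxr //=.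
  by rewrite opprD addrA addrNK.
apply: le_trans (ler_cabsD _ _) _.
have : cabs (\sum_(N.+1 <= n < K) cpow (n%:R + alpha) (- (sigma +i* t)%C)) <= e / 2.
  apply: le_trans (cabs_sum_nat _ _ _) _.
  by under eq_bigr => n _ do rewrite cabs_cpow_line.
move: MK; rewrite -/(hurwitz_partial _ _ _); lra.
Qed.

(** * The line Re s = 1 as a limit of the half-plane *)

Lemma increment_le_integral {R : realType} (f df g : R -> R) (a b l r : R) :
  a < b -> l <= a -> b <= r ->
  (forall x, a <= x <= b -> is_derive x 1 f (df x)) ->
  (forall x, a <= x <= b -> {for x, continuous df}) ->
  (forall x, a <= x <= b -> {for x, continuous g}) ->
  (forall x, a <= x <= b -> df x <= g x) ->
  (forall x, 0 <= g x) -> measurable_fun setT g ->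
  ((f b - f a)%:E <= \int[lebesgue_measure]_(x in `[l, r]) (g x)%:E)%E.
Proof.
move=> ab la br hf cdf cg dfg g0 mg.
have cont (h : R -> R) : (forall x, a <= x <= b -> {for x, continuous h}) ->
    {within `[a, b], continuous h}.
  move=> ch; apply: continuous_in_subspaceT => x.
  by rewrite inE /= in_itv /=; exact: ch.
have cf x : a <= x <= b -> {for x, continuous f}.
  by move=> /hf; exact: is_derive_continuous_at.
have e : (\int[lebesgue_measure]_(x in `[a, b]) (df x)%:E = (f b)%:E - (f a)%:E)%E.
  apply: continuous_FTC2 => //; first exact: cont.
    split.
    - move=> x; rewrite in_itv /= => /andP[ax xb].
      by apply: (@ex_derive _ _ _ _ _ _ _ (hf x _)); rewrite !ltW.
    - by apply: cvg_at_right_filter; apply: cf; rewrite lexx ltW.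
    - by apply: cvg_at_left_filter; apply: cf; rewrite lexx ltW.
  move=> x; rewrite in_itv /= => /andP[ax xb].
  rewrite derive1E; apply: (@derive_val _ _ _ _ _ _ _ (hf x _)).
  by rewrite !ltW.
rewrite EFinB -e.
apply: (@le_trans _ _ (\int[lebesgue_measure]_(x in `[a, b]) (g x)%:E)%E).
  apply: le_integral => //.
  - exact: continuous_compact_integrable (@segment_compact _ _ _) (cont _ cdf).
  - exact: continuous_compact_integrable (@segment_compact _ _ _) (cont _ cg).
  - by move=> x; rewrite inE /= in_itv /= lee_fin; exact: dfg.
apply: ge0_subset_integral => //.
- by apply/measurable_EFinP; exact: measurable_funTS.
- by move=> x _; rewrite lee_fin.
- by move=> x /=; rewrite !in_itv /= => /andP[ax xb]; rewrite (le_trans la ax) (le_trans xb br).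
Qed.

Lemma zeta_continuous {R : realType} (alpha : R) (Z : R[i] -> R[i]) (s : R[i]) (e : R) :
  is_hurwitz_zeta alpha Z -> s != 1 -> 0 < e ->
  exists2 d, 0 < d & forall w, cabs (s - w) < d -> cabs (Z s - Z w) < e.
Proof.
move=> [_ hZ] s1 e0.
have /derivable1_diffP /differentiable_continuous : derivable (Z : R[i]^o -> R[i]^o) s 1.
  exact: hZ.
move=> /cvgrPdist_lt /(_ (e%:C)%C); rewrite ltcR => /(_ e0) /nbhs_ballP[d /= d0 h].
have dR : d = ((complex.Re d)%:C)%C.
  by move: (gtr0_real d0); case: (d) => a b; rewrite complex_real /= => /eqP ->.
rewrite dR ltcR in d0.
exists (complex.Re d) => // w hw.
by have := h w; rewrite /ball /= !normr_cabs dR !ltcR; apply.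
Qed.

(** Compactness of [a, b] makes the limit sigma -> 1+ uniform in t, away from
    the pole. *)
Lemma zeta_near_line {R : realType} (alpha : R) (Z : R[i] -> R[i]) (a b e : R) :
  is_hurwitz_zeta alpha Z -> (forall t, a <= t <= b -> t != 0) -> 0 < e ->
  exists2 sigma, 1 < sigma &
    forall t, a <= t <= b -> cabs (Z (1 +i* t)%C - Z (sigma +i* t)%C) <= e.
Proof.
move=> hZ t0 e0.
have hx t : `[a, b]%classic t -> \forall t' \near t & sigma \near (1 : R)^'+,
    cabs (Z (1 +i* t')%C - Z (sigma +i* t')%C) <= e.
  rewrite /= in_itv /= => tab.
  have s1 : (1 +i* t)%C != 1 by rewrite eq_complex /= negb_and t0 ?orbT.
  have e2 : 0 < e / 2 by rewrite divr_gt0.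
  have [d d0 hd] := zeta_continuous _ _ _ _ hZ s1 e2.
  have d2 : 0 < d / 2 by rewrite divr_gt0.
  near=> t' sigma.
  have ht : `|t - t'| < d / 2 by near: t'; exact: (nbhsx_ballx t (d / 2)).
  have hs1 : 1 < sigma by near: sigma; exact: nbhs_right_gt.
  have hs2 : sigma < 1 + d / 2.
    by near: sigma; apply: nbhs_right_lt; rewrite ltrDl.
  have h1 : cabs (Z (1 +i* t)%C - Z (1 +i* t')%C) < e / 2.
    apply: hd; apply: le_lt_trans (cabs_le_add _ _) _ => /=.
    by rewrite subrr normr0; lra.
  have h2 : cabs (Z (1 +i* t)%C - Z (sigma +i* t')%C) < e / 2.
    apply: hd; apply: le_lt_trans (cabs_le_add _ _) _ => /=.
    by rewrite ltr0_norm; lra.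
  have -> : Z (1 +i* t')%C - Z (sigma +i* t')%C =
      - (Z (1 +i* t)%C - Z (1 +i* t')%C) + (Z (1 +i* t)%C - Z (sigma +i* t')%C).
    by ring.
  by apply: le_trans (ler_cabsD _ _) _; rewrite cabsN; lra.
have H := (compact_near_coveringP _).1 (@segment_compact _ a b) R (1 : R)^'+ _ _ hx.
near (1 : R)^'+ => sigma.
exists sigma; first by near: sigma; exact: nbhs_right_gt.
move=> t tab; have : `[a, b]%classic t by rewrite /= in_itv.
by move: t {tab}; near: sigma; exact: H.
Unshelve. all: by end_near. Qed.

Lemma measurable_cabs_zeta_line {R : realType} (alpha : R) (Z : R[i] -> R[i]) :
  is_hurwitz_zeta alpha Z ->
  (forall t : R, t != 0 -> {for t, continuous (fun t : R => cabs (Z (1 +i* t)%C))})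
  /\ measurable_fun setT (fun t : R => cabs (Z (1 +i* t)%C)).
Proof.
move=> hZ.
have ct : forall t : R, t != 0 -> {for t, continuous (fun t : R => cabs (Z (1 +i* t)%C))}.
  move=> t t0; apply/cvgrPdist_lt => e e0.
  have s1 : (1 +i* t)%C != 1 by rewrite eq_complex /= negb_and t0 ?orbT.
  have [d d0 hd] := zeta_continuous _ _ _ _ hZ s1 e0.
  near=> t'.
  have ht : `|t - t'| < d by near: t'; exact: (nbhsx_ballx t d).
  have : cabs (Z (1 +i* t)%C - Z (1 +i* t')%C) < e.
    apply: hd; apply: le_lt_trans (cabs_le_add _ _) _ => /=.
    by rewrite subrr normr0 add0r.
  have := ler_cabsD (Z (1 +i* t)%C - Z (1 +i* t')%C) (Z (1 +i* t')%C).
  have := ler_cabsD (- (Z (1 +i* t)%C - Z (1 +i* t')%C)) (Z (1 +i* t)%C).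
  by rewrite cabsN subrK opprB subrK ltr_norml; lra.
split=> //.
rewrite -(setvU [set 0 : R]).
apply/measurable_funU => //; first exact: measurableC.
split; last exact: measurable_fun_set1.
apply: open_continuous_measurable_fun.
  exact/closed_openC/closed_eq.
by move=> t; rewrite inE /= => /eqP; exact: ct.
Unshelve. all: by end_near. Qed.

(** * Size of the zeta-function near its pole *)

Lemma expR_line_le {R : realType} (alpha sigma x : R) :
  0 < alpha -> alpha <= 1 -> 1 <= sigma -> sigma <= 2 -> alpha <= x ->
  expR (- sigma * ln x) <= alpha^-1 * x^-1.
Proof.
move=> a0 a1 s1 s2 ax; have x0 : 0 < x by exact: lt_le_trans ax.
have -> : alpha^-1 * x^-1 = expR (- ln alpha - ln x).
  by rewrite expRD !expRN !lnK.
rewrite ler_expR.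
have la : ln alpha <= 0 by exact: ln_le0.
have lx : ln alpha <= ln x by rewrite ler_ln.
have h1 : 0 <= (sigma - 1) * (ln x - ln alpha) by rewrite mulr_ge0 // subr_ge0.
have h2 : 0 <= (2 - sigma) * (- ln alpha) by rewrite mulr_ge0 ?oppr_ge0 ?subr_ge0.
lra.
Qed.

(** The opposite of the imaginary part of x^(- (sigma + i t)). *)
Definition osc {R : realType} (sigma t x : R) : R :=
  expR (- sigma * ln x) * sin (t * ln x).

(** The primitive of [osc sigma t] that vanishes at infinity for sigma > 1; at
    alpha it is of size 1 / |t| when sigma is close to 1, which reflects the
    pole. *)
Definition osc_prim {R : realType} (sigma t x : R) : R :=
  expR ((1 - sigma) * ln x) * ((1 - sigma) * sin (t * ln x) - t * cos (t * ln x))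
    / ((sigma - 1) ^+ 2 + t ^+ 2).

Lemma is_derive_osc {R : realType} (sigma t x : R) : 0 < x ->
  is_derive x 1 (osc sigma t)
    (x^-1 * expR (- sigma * ln x) * (- sigma * sin (t * ln x) + t * cos (t * ln x))).
Proof.
move=> x0; have d := @is_derive1_ln _ x x0.
by apply: is_derive_eq; rewrite /GRing.scale /=; ring.
Qed.

Lemma is_derive_osc_prim {R : realType} (sigma t x : R) : 0 < x -> t != 0 ->
  is_derive x 1 (osc_prim sigma t) (osc sigma t x).
Proof.
move=> x0 t0; have d := @is_derive1_ln _ x x0.
have D0 : (sigma - 1) ^+ 2 + t ^+ 2 != 0.
  by rewrite gt_eqF // ltr_wpDl ?sqr_ge0 // exprn_even_gt0.
have e : expR ((1 - sigma) * ln x) = x * expR (- sigma * ln x).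
  by rewrite mulrBl mul1r expRD lnK // mulNr.
apply: is_derive_eq; rewrite /GRing.scale /= /osc e; field.
by rewrite D0 gt_eqF.
Qed.

(** Comparison of a sum with an integral: on an interval of length 1 the
    function varies by at most the supremum of its derivative, which is
    summable over n, uniformly in sigma and t. *)
Lemma osc_step {R : realType} (alpha sigma t : R) n :
  0 < alpha -> alpha <= 1 -> 1 <= sigma -> sigma <= 2 -> t != 0 -> `|t| <= 1 ->
  `|osc sigma t (n%:R + alpha)
     - (osc_prim sigma t (n.+1%:R + alpha) - osc_prim sigma t (n%:R + alpha))|
   <= 3 / alpha * (n%:R + alpha) ^- 2.
Proof.
move=> a0 a1 s1 s2 t0 t1.
set x := n%:R + alpha.
have [M ME] : {M : R | M = 3 / alpha * x ^- 2} by exists (3 / alpha * x ^- 2).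
rewrite -ME.
have ax : alpha <= x by rewrite lerDr.
have x0 : 0 < x by exact: lt_le_trans ax.
have -> : n.+1%:R + alpha = x + 1 by rewrite /x -natr1; ring.
have M0 : 0 <= M by rewrite ME mulr_ge0 ?invr_ge0 ?exprn_ge0 ?divr_ge0 // ltW.
have bound y : x <= y -> `|y^-1 * expR (- sigma * ln y) *
    (- sigma * sin (t * ln y) + t * cos (t * ln y))| <= M.
  move=> xy; have y0 : 0 < y by exact: lt_le_trans xy.
  have -> : M = x^-1 * (alpha^-1 * x^-1) * 3.
    by rewrite ME; field; rewrite !gt_eqF.
  have iy : y^-1 <= x^-1 by rewrite lef_pV2.
  have ay : alpha <= y by exact: le_trans ax xy.
  rewrite !normrM; apply: ler_pM; rewrite ?mulr_ge0 //.
    apply: ler_pM => //; first by rewrite gtr0_norm ?invr_gt0.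
    rewrite ger0_norm ?expR_ge0 //; apply: le_trans (expR_line_le _ _ _ a0 a1 s1 s2 ay) _.
    by rewrite ler_wpM2l // invr_ge0 ltW.
  apply: le_trans (ler_normD _ _) _.
  rewrite !normrM normrN (ger0_norm (le_trans ler01 s1)).
  have c1 : `|cos (t * ln y)| <= 1 by rewrite ler_norml cos_geN1 cos_le1.
  have c2 : `|sin (t * ln y)| <= 1 by rewrite ler_norml sin_geN1 sin_le1.
  have := ler_pM (normr_ge0 _) (normr_ge0 _) t1 c1.
  have := ler_pM (le_trans ler01 s1) (normr_ge0 _) s2 c2.
  lra.
pose f y := osc sigma t x * (y - x) - osc_prim sigma t y.
have -> : osc sigma t x - (osc_prim sigma t (x + 1) - osc_prim sigma t x) =
    f (x + 1) - f x by rewrite /f; ring.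
apply: (@le_trans _ _ (M * (x + 1) - M * x)); last by rewrite -mulrBr addrAC subrr add0r mulr1.
have dM (y : R) : is_derive y 1 (fun y => M * y) M.
  by apply: is_derive_eq; rewrite /GRing.scale /=; ring.
apply: (@le_increment _ f (fun y => osc sigma t x - osc sigma t y)
  (fun y => M * y) (fun=> M) x (x + 1)).
- by rewrite lerDl.
- move=> y /andP[xy _]; have y0 : 0 < y by exact: lt_le_trans xy.
  have d := is_derive_osc_prim sigma t y y0 t0.
  by apply: is_derive_eq; rewrite /GRing.scale /=; ring.
move=> y /andP[xy yx]; rewrite distrC.
apply: (@le_trans _ _ (M * y - M * x)).
  apply: (@le_increment _ (osc sigma t) _ (fun y => M * y) (fun=> M) x y xy).
  - by move=> z /andP[xz _]; apply: is_derive_osc; exact: lt_le_trans xz.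
  - by move=> z /andP[xz _]; exact: bound.
by rewrite -mulrBr -[leRHS]mulr1 ler_wpM2l //; lra.
Qed.

Lemma sum_inv_sqr_le {R : realType} (alpha : R) N : 0 < alpha ->
  \sum_(0 <= n < N) (n%:R + alpha) ^- 2 <= alpha ^- 2 + alpha^-1.
Proof.
move=> a0; have x0 n : 0 < n%:R + alpha by rewrite ltr_wpDl.
case: N => [|N]; first by rewrite big_nil addr_ge0 ?invr_ge0 ?exprn_ge0 // ltW.
suff : \sum_(0 <= n < N.+1) (n%:R + alpha) ^- 2 <=
    alpha ^- 2 + alpha^-1 - (N%:R + alpha)^-1.
  have : 0 < (N%:R + alpha)^-1 by rewrite invr_gt0.
  lra.
elim: N => [|N IH]; first by rewrite big_nat1 add0r addrK.
rewrite big_nat_recr //=.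
have : (N.+1%:R + alpha) ^- 2 <= (N%:R + alpha)^-1 - (N.+1%:R + alpha)^-1.
  have := x0 N; have := x0 N.+1; rewrite -natr1; set x := N%:R + alpha => y0 xp.
  have e : N%:R + 1 + alpha = x + 1 by rewrite /x; ring.
  rewrite e in y0 *.
  have -> : x^-1 - (x + 1)^-1 = (x * (x + 1))^-1 by field; rewrite !gt_eqF.
  rewrite lef_pV2 ?posrE ?exprn_gt0 ?mulr_gt0 // expr2 ler_wpM2r //; lra.
lra.
Qed.

Lemma sum_osc {R : realType} (alpha sigma t : R) N :
  0 < alpha -> alpha <= 1 -> 1 <= sigma -> sigma <= 2 -> t != 0 -> `|t| <= 1 ->
  `|\sum_(0 <= n < N) osc sigma t (n%:R + alpha)
     - (osc_prim sigma t (N%:R + alpha) - osc_prim sigma t alpha)|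
   <= 3 / alpha * (alpha ^- 2 + alpha^-1).
Proof.
move=> a0 a1 s1 s2 t0 t1.
have -> : osc_prim sigma t (N%:R + alpha) - osc_prim sigma t alpha =
    \sum_(0 <= n < N) (osc_prim sigma t (n.+1%:R + alpha) - osc_prim sigma t (n%:R + alpha)).
  by rewrite (telescope_sumr (fun n => osc_prim sigma t (n%:R + alpha))) // add0r.
rewrite -sumrB; apply: le_trans (ler_norm_sum _ _ _) _.
apply: (@le_trans _ _ (\sum_(0 <= n < N) 3 / alpha * (n%:R + alpha) ^- 2)).
  by apply: ler_sum => n _; exact: osc_step.
by rewrite -mulr_sumr ler_wpM2l ?sum_inv_sqr_le // divr_ge0 // ltW.
Qed.

Lemma cos_near0 {R : realType} : exists2 r : R, 0 < r &
  forall x, `|x| < r -> 7 / 8 <= cos x.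
Proof.
have e0 : 0 < 1 / 8 :> R by lra.
have /cvgrPdist_lt /(_ _ e0) /nbhs_ballP[r /= r0 h] := @continuous_cos R 0.
exists r => // x xr; have := h x; rewrite /ball /= sub0r normrN => /(_ xr).
by rewrite cos0 ltr_norml; lra.
Qed.

Lemma osc_prim_decay {R : realType} (alpha sigma t : R) M :
  0 < alpha -> 1 < sigma -> t != 0 ->
  exists2 n, (M <= n)%N & `|osc_prim sigma t (n%:R + alpha)| <= 1.
Proof.
move=> a0 s1 t0.
have D0 : 0 < (sigma - 1) ^+ 2 + t ^+ 2.
  by rewrite ltr_wpDl ?sqr_ge0 // exprn_even_gt0.
pose K := ((sigma - 1) + `|t|) / ((sigma - 1) ^+ 2 + t ^+ 2).
have K0 : 0 <= K by rewrite divr_ge0 ?(ltW D0) // addr_ge0 // subr_ge0 ltW.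
pose L := K / (sigma - 1).
pose n := (M + (Num.trunc (expR L)).+1)%N.
exists n; first exact: leq_addr.
have Ln : expR L <= n%:R + alpha.
  have h : expR L < (Num.trunc (expR L)).+1%:R by apply: truncnS_gt; exact: expR_ge0.
  rewrite /n natrD; have := ler0n R M; lra.
have n0 : 0 < n%:R + alpha by rewrite ltr_wpDl.
have {}Ln : L <= ln (n%:R + alpha) by rewrite -(expRK L) ler_ln ?posrE ?expR_gt0.
set y := ln _ in Ln *.
apply: (@le_trans _ _ (expR ((1 - sigma) * y) * K)).
  rewrite /osc_prim -/y !normrM -mulrA ger0_norm ?expR_ge0 // ler_wpM2l ?expR_ge0 //.
  rewrite normfV (gtr0_norm D0) ler_wpM2r ?invr_ge0 ?(ltW D0) //.
  apply: le_trans (ler_normB _ _) _; rewrite !normrM -normrN opprB.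
  rewrite (gtr0_norm (_ : 0 < sigma - 1)) ?subr_gt0 //.
  apply: lerD; rewrite -[leRHS]mulr1 ler_wpM2l //.
  - by rewrite subr_ge0 ltW.
  - by rewrite ler_norml sin_geN1 sin_le1.
  - by rewrite ler_norml cos_geN1 cos_le1.
have KL : K <= (sigma - 1) * y.
  by rewrite mulrC -ler_pdivrMr // subr_gt0.
have -> : (1 - sigma) * y = - ((sigma - 1) * y) by ring.
rewrite expRN mulrC ler_pdivrMr ?expR_gt0 // mul1r.
by have := expR_ge1Dx ((sigma - 1) * y); lra.
Qed.

Lemma osc_prim_ge {R : realType} (alpha sigma t : R) :
  0 < alpha -> alpha <= 1 -> 1 < sigma -> t != 0 -> sigma - 1 <= `|t| / 8 ->
  7 / 8 <= cos (t * ln alpha) -> (2 * `|t|)^-1 <= `|osc_prim sigma t alpha|.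
Proof.
move=> a0 a1 s1 t0 st hc.
have tp : 0 < `|t| by rewrite normr_gt0.
have D0 : 0 < (sigma - 1) ^+ 2 + t ^+ 2.
  by rewrite ltr_wpDl ?sqr_ge0 // exprn_even_gt0.
have D1 : (sigma - 1) ^+ 2 + t ^+ 2 <= 65 / 64 * `|t| ^+ 2.
  have : (sigma - 1) ^+ 2 <= (`|t| / 8) ^+ 2.
    by apply: lerXn2r; rewrite ?nnegrE ?subr_ge0 ?divr_ge0 // ltW.
  rewrite -(real_normK (num_real t)) exprMn => h; lra.
have E1 : 1 <= expR ((1 - sigma) * ln alpha).
  have : 0 <= (sigma - 1) * (- ln alpha).
    by rewrite mulr_ge0 ?subr_ge0 ?(ltW s1) // oppr_ge0 ln_le0.
  have := expR_ge1Dx ((1 - sigma) * ln alpha); lra.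
have N1 : 3 / 4 * `|t| <= `|(1 - sigma) * sin (t * ln alpha) - t * cos (t * ln alpha)|.
  rewrite distrC; apply: le_trans (lerB_dist _ _).
  rewrite !normrM -(normrN (1 - sigma)) opprB (gtr0_norm (_ : 0 < sigma - 1)) ?subr_gt0 //.
  have h1 : `|t| * (7 / 8) <= `|t| * `|cos (t * ln alpha)|.
    by rewrite ler_wpM2l //; apply: le_trans hc (ler_norm _).
  have h2 : (sigma - 1) * `|sin (t * ln alpha)| <= `|t| / 8 * 1.
    by apply: ler_pM => //; rewrite ?subr_ge0 ?(ltW s1) // ler_norml sin_geN1 sin_le1.
  lra.
rewrite /osc_prim !normrM normfV (gtr0_norm D0) (ger0_norm (expR_ge0 _)).
rewrite ler_pdivlMr // ler_pdivrMl ?mulr_gt0 //.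
have h3 : 1 * (3 / 4 * `|t|) <= expR ((1 - sigma) * ln alpha) *
    `|(1 - sigma) * sin (t * ln alpha) - t * cos (t * ln alpha)|.
  by apply: ler_pM => //; rewrite mulr_ge0 // divr_ge0.
have h4 := ler_wpM2l (mulr_ge0 (ler0n R 2) (ltW tp)) h3.
apply: le_trans D1 _; apply: le_trans h4.
have := sqr_ge0 `|t|; lra.
Qed.

(** The imaginary part of zeta (sigma + i t, alpha) is osc_prim (alpha) up to
    a constant depending on alpha only, hence at least about 1 / |t| in
    absolute value when sigma - 1 is small with respect to t; continuity at
    1 + i t transfers the bound to the line. *)
Lemma zeta_pole_lower_bound {R : realType} (alpha : R) (Z : R[i] -> R[i]) :
  0 < alpha -> alpha <= 1 -> is_hurwitz_zeta alpha Z ->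
  exists2 eta, 0 < eta &
    forall t, t != 0 -> `|t| <= eta -> (4 * `|t|)^-1 <= cabs (Z (1 +i* t)%C).
Proof.
move=> a0 a1 hZ.
have [r r0 hr] := @cos_near0 R.
pose C := 3 / alpha * (alpha ^- 2 + alpha^-1) + 3.
have C0 : 0 < C.
  by rewrite ltr_wpDl // mulr_ge0 ?divr_ge0 ?addr_ge0 ?invr_ge0 ?exprn_ge0 // ltW.
have q0 : 0 < `|ln alpha| + 1 by rewrite ltr_wpDl.
(* The second bound absorbs the constant [C] into half of 1 / (2 |t|), the
   third one keeps cos (t ln alpha) close to 1. *)
pose eta := Num.min (Num.min 1 (4 * C)^-1) (r / 2 / (`|ln alpha| + 1)).
have eta0 : 0 < eta by rewrite !lt_min ltr01 invr_gt0 mulr_gt0 //= !divr_gt0.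
exists eta => // t t0; rewrite !le_min => /andP[/andP[t1 tC] tr].
have tp : 0 < `|t| by rewrite normr_gt0.
have hc : 7 / 8 <= cos (t * ln alpha).
  apply: hr; rewrite normrM; move: tr; rewrite ler_pdivlMr // => tr.
  by have : `|t| * `|ln alpha| <= `|t| * (`|ln alpha| + 1); [rewrite ler_wpM2l // lerDl|lra].
have s1 : (1 +i* t)%C != 1 by rewrite eq_complex /= negb_and t0 orbT.
have [d d0 hd] := zeta_continuous _ _ _ _ hZ s1 (@ltr01 R).
pose sg := 1 + Num.min (d / 2) (`|t| / 8).
have m0 : 0 < Num.min (d / 2) (`|t| / 8) by rewrite lt_min !divr_gt0.
have sg1 : 1 < sg by rewrite /sg ltrDl.
have sgd : sg - 1 <= d / 2 by rewrite /sg addrAC subrr add0r ge_min lexx.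
have sgt : sg - 1 <= `|t| / 8 by rewrite /sg addrAC subrr add0r ge_min lexx orbT.
have sg2 : sg <= 2 by lra.
have h1 : cabs (Z (1 +i* t)%C - Z (sg +i* t)%C) < 1.
  apply: hd; apply: le_lt_trans (cabs_le_add _ _) _ => /=.
  by rewrite subrr normr0 addr0 distrC gtr0_norm; lra.
have [M hM] := cvg_cabs_lt _ _ _ (@ltr01 R) (hZ.1 (sg +i* t)%C sg1).
have [n Mn hn] := osc_prim_decay alpha sg t M a0 sg1 t0.
have {hM}h2 := hM _ Mn; rewrite -/(hurwitz_partial alpha n _) in h2.
have h3 := sum_osc alpha sg t n a0 a1 (ltW sg1) sg2 t0 t1.
have h4 := osc_prim_ge alpha sg t a0 a1 sg1 t0 sgt hc.
have h5 : `|\sum_(0 <= k < n) osc sg t (k%:R + alpha)| <= cabs (hurwitz_partial alpha n (sg +i* t)%C).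
  have := Im_hurwitz_partial alpha sg t n; rewrite -/(osc _ _ _) => e.
  have -> : \sum_(0 <= k < n) osc sg t (k%:R + alpha) =
      - complex.Im (hurwitz_partial alpha n (sg +i* t)%C) by rewrite e opprK.
  set w := hurwitz_partial _ _ _; rewrite normrN ler_norml; apply/andP; split.
    by have := rotated_re_le_cabs (- (pi / 2)) w; rewrite cosN sinN cos_pihalf sin_pihalf; lra.
  by have := rotated_re_le_cabs (pi / 2) w; rewrite cos_pihalf sin_pihalf; lra.
set S := \sum_(0 <= k < n) _ in h3 h5.
set Z1 := Z (1 +i* t)%C in h1 *; set Z2 := Z (sg +i* t)%C in h1 h2.
set zn := hurwitz_partial _ _ _ in h2 h5.
have h6 : cabs zn <= cabs Z1 + 2.
  have -> : zn = Z1 + (- (Z1 - Z2) + - (Z2 - zn)) by ring.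
  have := ler_cabsD Z1 (- (Z1 - Z2) + - (Z2 - zn)).
  by have := ler_cabsD (- (Z1 - Z2)) (- (Z2 - zn)); rewrite !cabsN; lra.
have h7 : `|osc_prim sg t alpha| <= `|S| + (C - 3) + 1.
  set A := osc_prim sg t (n%:R + alpha) in hn h3.
  set a := osc_prim sg t alpha in h3 *.
  have -> : a = (S - (A - a)) - S + A by ring.
  have := ler_normD (S - (A - a) - S) A; have := ler_normB (S - (A - a)) S.
  rewrite /C; lra.
have h8 : C <= (4 * `|t|)^-1.
  rewrite -[C]invrK lef_pV2 ?posrE ?mulr_gt0 ?invr_gt0 // mulrC -ler_pdivlMr //.
  by rewrite -invfM mulrC.
have h9 : (2 * `|t|)^-1 = 2 * (4 * `|t|)^-1 by field; rewrite normr_eq0.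
lra.
Qed.

(** * Lower bound of the integral *)

(** If the interval contains 0 the integral exceeds every m, since |zeta| is at
    least 1 / (4 |t|) on one side of 0 at least, where the interval has length
    delta / 2: between b exp (- 4 m) and b this already contributes m. *)
Lemma line1_integral_through_pole {R : realType} (alpha delta T : R)
    (Z : R[i] -> R[i]) (m : R) :
  0 < alpha -> alpha <= 1 -> 0 < delta -> is_hurwitz_zeta alpha Z ->
  T <= 0 <= T + delta -> 0 < m -> (m%:E <= line1_integral Z T delta)%E.
Proof.
move=> a0 a1 d0 hZ /andP[T0 Td0] m0.
have [eta eta0 heta] := @zeta_pole_lower_bound _ alpha Z a0 a1 hZ.
have [cg mg] := @measurable_cabs_zeta_line _ alpha Z hZ.
pose b := Num.min eta (delta / 2); pose a := b * expR (- (4 * m)).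
have b0 : 0 < b by rewrite lt_min eta0 divr_gt0.
have a00 : 0 < a by rewrite mulr_gt0 ?expR_gt0.
have ab : a < b by rewrite -[ltRHS]mulr1 ltr_pM2l // expR_lt1 oppr_lt0 mulr_gt0.
have be : b <= eta by rewrite ge_min lexx.
have bd : b <= delta / 2 by rewrite ge_min lexx orbT.
have lnab : ln b / 4 - ln a / 4 = m.
  by rewrite /a lnM ?posrE ?expR_gt0 // expRK; field.
have near x : a <= `|x| <= b -> (4 * `|x|)^-1 <= cabs (Z (1 +i* x)%C).
  move=> /andP[ax xb]; apply: heta; last exact: le_trans be.
  by rewrite -normr_gt0 (lt_le_trans a00).
have cinv x : x != 0 -> {for x, continuous (fun y : R => (4 * y)^-1)}.
  move=> x0; apply: (@is_derive_continuous_at _ _ (- (4 * x) ^- 2 * 4)).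
  have x4 : 4 * x != 0 by rewrite mulf_neq0.
  by apply: is_derive_eq; rewrite /GRing.scale /=; ring.
(* The longer side of 0 is the left one in the first case. *)
case: (leP (T + delta) (delta / 2)) => hT.
- have -> : m = (- ln (- - a) / 4) - (- ln (- - b) / 4) by rewrite !opprK -lnab; ring.
  apply: (@increment_le_integral _ (fun x => - ln (- x) / 4) (fun x => (4 * (- x))^-1)
    (fun t => cabs (Z (1 +i* t)%C)) (- b) (- a)) => //; try lra.
  + move=> x /andP[bx xa]; have x0 : 0 < - x by lra.
    have d := @is_derive1_ln _ (- x) x0.
    by apply: is_derive_eq; rewrite /GRing.scale /=; field; lra.
  + move=> x /andP[bx xa]; have x0 : - x != 0 by rewrite oppr_eq0; lra.
    by apply: (@continuous_comp _ _ _ -%R (fun y : R => (4 * y)^-1)) => //;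
      [exact: opp_continuous|exact: cinv].
  + by move=> x /andP[bx xa]; apply: cg; lra.
  + move=> x /andP[bx xa]; have x0 : x < 0 by lra.
    by rewrite -(ltr0_norm x0); apply: near; rewrite ltr0_norm //; lra.
  + by move=> x; exact: cabs_ge0.
- rewrite -lnab.
  apply: (@increment_le_integral _ (fun x => ln x / 4) (fun x => (4 * x)^-1)
    (fun t => cabs (Z (1 +i* t)%C)) a b) => //; try lra.
  + move=> x /andP[ax xb]; have x0 : 0 < x by lra.
    have d := @is_derive1_ln _ x x0.
    by apply: is_derive_eq; rewrite /GRing.scale /=; field; lra.
  + by move=> x /andP[ax xb]; apply: cinv; lra.
  + by move=> x /andP[ax xb]; apply: cg; lra.
  + move=> x /andP[ax xb]; have x0 : 0 < x by lra.
    by rewrite -{1}(gtr0_norm x0); apply: near; rewrite gtr0_norm //; lra.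
  + by move=> x; exact: cabs_ge0.
Qed.

(** The real trigonometric sums of [hurwitz_poly_lower_bound] are real parts of
    the partial sums of zeta multiplied by complex numbers of modulus 1. *)
Lemma trig_sum_hurwitz_partial {R : realType} (alpha sigma B th t : R) N :
  trig_sum (fun i : 'I_N => expR (- sigma * ln (i%:R + alpha)))
       (fun i => log_ratio alpha i + B) th t =
  cos (t * (B - ln alpha) + th) * complex.Re (hurwitz_partial alpha N (sigma +i* t)%C)
  + sin (t * (B - ln alpha) + th) * complex.Im (hurwitz_partial alpha N (sigma +i* t)%C).
Proof.
rewrite Re_hurwitz_partial Im_hurwitz_partial mulrN !big_mkord !mulr_sumr -sumrB.
apply: eq_bigr => i _; rewrite /log_ratio.
have -> : (ln (i%:R + alpha) - ln alpha + B) * t + th =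
   t * ln (i%:R + alpha) + (t * (B - ln alpha) + th) by ring.
by rewrite cosD; ring.
Qed.

(** Off the pole, zeta on the line is a uniform limit of partial sums at some
    sigma > 1, whose primitives therefore have increments at most the integral
    plus an arbitrary e; replacing th by th + pi bounds the opposite increments
    as well. *)
Lemma line1_integral_off_pole {R : realType} (alpha delta T : R) (Z : R[i] -> R[i]) :
  0 < alpha -> alpha <= 1 -> 0 < delta -> is_hurwitz_zeta alpha Z ->
  ~~ (T <= 0 <= T + delta) ->
  ((alpha^-1 * (delta / 240) * expR (- (81 / (4 * delta))))%:E
    <= line1_integral Z T delta)%E.
Proof.
move=> a0 a1 d0 hZ T0.
have t0 t : T <= t <= T + delta -> t != 0.
  by move=> ht; apply: contra T0 => /eqP <-.
have [cg mg] := @measurable_cabs_zeta_line _ alpha Z hZ.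
have I0 : (0 <= line1_integral Z T delta)%E.
  by apply: integral_ge0 => x _; rewrite lee_fin cabs_ge0.
case E : (line1_integral Z T delta) I0 => [J| |] //; last by move=> _; exact: leey.
rewrite !lee_fin => J0; apply/ler_addgt0Pr => e e0.
have e1 : 0 < e / delta / 2 by rewrite !divr_gt0.
have [sigma s1 hs] := @zeta_near_line _ alpha Z T (T + delta) _ hZ t0 e1.
have [N hN] := @hurwitz_partial_unif _ alpha sigma _ Z hZ s1 e1.
have close t : T <= t <= T + delta ->
    cabs (hurwitz_partial alpha N.+1 (sigma +i* t)%C) <= cabs (Z (1 +i* t)%C) + e / delta.
  move=> /hs; have := hN t.
  set z := hurwitz_partial _ _ _; set Z1 := Z (1 +i* t)%C; set Z2 := Z _.
  have -> : z = Z1 + (- (Z1 - Z2) + - (Z2 - z)) by ring.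
  have := ler_cabsD Z1 (- (Z1 - Z2) + - (Z2 - z)).
  have := ler_cabsD (- (Z1 - Z2)) (- (Z2 - z)); rewrite !cabsN.
  have -> : Z2 - (Z1 + (- (Z1 - Z2) + - (Z2 - z))) = Z2 - z by ring.
  lra.
set B := 81 / (2 * delta ^+ 2).
pose p (i : 'I_N.+1) := expR (- sigma * ln (i%:R + alpha)).
pose u (i : 'I_N.+1) := log_ratio alpha i + B.
have B0 : 0 < B by rewrite divr_gt0 ?mulr_gt0 ?exprn_gt0.
have u0 i : u i != 0.
  by rewrite gt_eqF // ltr_wpDl // -(log_ratio0 alpha) log_ratio_le.
have up th a b : T <= a -> a <= b -> b <= T + delta ->
    trig_prim p u th b - trig_prim p u th a <= J + e.
  move=> Ta; rewrite le_eqVlt => /orP[/eqP ->|ab] bT; first by rewrite subrr addr_ge0 // ltW.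
  have : ((trig_prim p u th b - e / delta * b - (trig_prim p u th a - e / delta * a))%:E
      <= line1_integral Z T delta)%E.
    apply: (@increment_le_integral _ (fun t => trig_prim p u th t - e / delta * t)
      (fun t => trig_sum p u th t - e / delta) (fun t => cabs (Z (1 +i* t)%C)) a b) => //.
    - move=> x _; have d := is_derive_trig_prim p u th x u0.
      by apply: is_derive_eq; rewrite /GRing.scale /=; ring.
    - move=> x _; apply: (@is_derive_continuous_at _ _
        (\sum_(i < N.+1) p i * (- sin (u i * x + th) * u i))).
      rewrite -[X in is_derive _ _ _ X]subr0.
      apply: is_deriveB; apply: is_derive_sum_fun => i.
      by apply: is_derive_eq; rewrite /GRing.scale /=; ring.
    - by move=> x /andP[ax xb]; apply: cg; apply: t0; rewrite (le_trans Ta) // (le_trans xb).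
    - move=> x /andP[ax xb].
      have := close x; rewrite (le_trans Ta) // (le_trans xb) // => /(_ isT).
      have := rotated_re_le_cabs (x * (B - ln alpha) + th)
        (hurwitz_partial alpha N.+1 (sigma +i* x)%C).
      by rewrite -trig_sum_hurwitz_partial -/p -/u; lra.
    - by move=> x; exact: cabs_ge0.
  rewrite E lee_fin.
  have : e / delta * (b - a) <= e.
    rewrite -[leRHS](divfK (lt0r_neq0 d0)) ler_wpM2l ?divr_ge0 ?(ltW e0) ?(ltW d0) //; lra.
  lra.
have core := @hurwitz_poly_lower_bound _ alpha delta sigma (J + e) T N a0 a1 (ltW s1) d0.
have {}core : expR (- sigma * ln alpha) * (delta / 240) <= (J + e) * expR (81 / (4 * delta)).
  apply: core => th a b Ta ab bT; rewrite ler_norml up // andbT.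
  have := up (th + pi) a b Ta ab bT.
  have neg t : trig_prim p u (th + pi) t = - trig_prim p u th t.
    rewrite /trig_prim -sumrN; apply: eq_bigr => i _.
    by rewrite addrA sinDpi mulrN.
  rewrite !neg -/p -/u; lra.
rewrite expRN ler_pdivrMr ?expR_gt0 //; apply: le_trans core.
rewrite ler_wpM2r ?divr_ge0 ?(ltW d0) //.
rewrite -[alpha^-1](lnK (x := alpha^-1)) ?posrE ?invr_gt0 // ler_expR lnV ?posrE //.
have : 0 <= (sigma - 1) * (- ln alpha).
  by rewrite mulr_ge0 ?subr_ge0 ?(ltW s1) // oppr_ge0 ln_le0.
lra.
Qed.

(** Since 9 ln 10 - 81/4 >= 9/20, it is enough that 240 y <= exp (9 y / 20)
    for y = 1 / delta >= 20; at y = 20 it reads 4800 <= exp 9, and the right-hand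
    side then grows faster. *)
Lemma powR10_le_expR {R : realType} (delta : R) : 0 < delta -> delta <= 5 / 100 ->
  10 `^ (- (9 / delta)) <= delta / 240 * expR (- (81 / (4 * delta))).
Proof.
move=> d0 d1; pose y := delta^-1.
have y0 : 0 < y by rewrite invr_gt0.
have y20 : 20 <= y by rewrite -[20]invrK lef_pV2 ?posrE //; lra.
have -> : 10 `^ (- (9 / delta)) = expR (- (9 * ln 10 * y)).
  by rewrite /powR ifF ?gt_eqF //; congr expR; rewrite /y; ring.
have -> : delta / 240 * expR (- (81 / (4 * delta))) =
    (240 * y)^-1 * expR (- (81 / 4 * y)).
  by congr (_ * expR _); rewrite /y; field; lra.
rewrite -ler_pdivrMr ?expR_gt0 // -expRN opprK -expRD.
rewrite -[leRHS]invrK -[leLHS]invrK lef_pV2 ?posrE ?invr_gt0 ?invrK ?expR_gt0 ?mulr_gt0 //.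
rewrite -expRN opprD opprK.
have h1 : 9 / 20 * y <= 9 * ln 10 * y - 81 / 4 * y.
  have := @ln10_ge R; rewrite -mulrBl ler_pM2r //; lra.
apply: (@le_trans _ _ (expR (9 / 20 * y))); last by rewrite ler_expR.
have -> : 9 / 20 * y = 9 + 9 / 20 * (y - 20) by field.
rewrite expRD.
have h2 := @expR9_ge R; have h3 := expR_ge1Dx (9 / 20 * (y - 20)).
have h4 : 0 <= 9 / 20 * (y - 20) by rewrite mulr_ge0 ?subr_ge0 ?divr_ge0.
apply: (@le_trans _ _ (4800 * (1 + 9 / 20 * (y - 20)))); first by lra.
apply: ler_pM; [lra|lra|exact: h2|exact: h3].
Qed.

Theorem theorem27 (R : realType) (alpha delta : R) (zeta : R[i] -> R[i])
    (alpha_gt0 : 0 < alpha) (alpha_le1 : alpha <= 1)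
    (delta_gt0 : 0 < delta) (delta_le : delta <= 5%:R / 100%:R)
    (zetaP : is_hurwitz_zeta alpha zeta) :
  ((alpha^-1 * (1 + alpha / delta) `^ (- (7%:R / (6%:R * delta)))
      * 10%:R `^ (- (9%:R / delta)))%:E
   <= ereal_inf (range (fun T : R => line1_integral zeta T delta)))%E.
Proof.
apply: le_ereal_inf_tmp => _ [T _ <-].
have i0 : 0 < alpha^-1 by rewrite invr_gt0.
have c0 : 0 < alpha^-1 * (delta / 240) * expR (- (81 / (4 * delta))).
  by rewrite !mulr_gt0 ?expR_gt0 // divr_gt0.
apply: (@le_trans _ _ (alpha^-1 * (delta / 240) * expR (- (81 / (4 * delta))))%:E).
  rewrite lee_fin -!mulrA ler_pM2l // -[leRHS]mul1r.
  apply: ler_pM; rewrite ?powR_ge0 //; last by rewrite [leRHS]mulrA; exact: powR10_le_expR.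
  apply: (@le_trans _ _ ((1 + alpha / delta) `^ 0)); last by rewrite powRr0.
  rewrite ler_powR //.
    by rewrite lerDl divr_ge0 // ltW.
  by rewrite oppr_le0 divr_ge0 // mulr_ge0 // ltW.
case: (boolP (T <= 0 <= T + delta)) => hT.
  exact: (@line1_integral_through_pole _ alpha delta T zeta _
    alpha_gt0 alpha_le1).
exact: (@line1_integral_off_pole _ alpha).
Qed.
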